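(* Let $f:\mathbb{R}^n\to\mathbb{R}$ be locally Lipschitz on $\mathbb{R}^n$ and let $\bar x\in\mathbb{R}^n$. Then the following are equivalent. (i) $\operatorname{epi}f$ is Clarke super-regular at $(\bar x,f(\bar x))$. (ii) $f$ is approximately convex at $\bar x$. (iii) For every $\varepsilon>0$ there exists $\delta>0$ such that for all $x,y\in\mathbb{B}_\delta(\bar x)$ and all $v\in\partial^{\mathrm C}f(x)$, $$f(y)-f(x)\ge\langle v,y-x\rangle-\varepsilon\|y-x\|.$$ (iv) $\partial f$ is submonotone at $\bar x$, that is, for every $\varepsilon>0$ there is $\delta>0$ such that for all $x_1,x_2\in\mathbb{B}_\delta(\bar x)\cap\operatorname{dom}\partial f$ and all $x_i^*\in\partial f(x_i)$ ($i=1,2$), $$\langle x_1^*-x_2^*,x_1-x_2\rangle\ge-\varepsilon\|x_1-x_2\|.$$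
   Context: $\mathbb{B}_r(x)$ is the closed Euclidean ball of radius $r$ centered at $x$. $\operatorname{epi}f=\{(x,\alpha)\in\mathbb{R}^n\times\mathbb{R}: f(x)\le\alpha\}$. Normal cones. For a set $\Omega$ in a Euclidean space and $\omega\in\Omega$: - The Fréchet normal cone $\hat N_\Omega(\omega)$ is the set of vectors $w$ such that for every $\varepsilon>0$ there is $\delta>0$ with $\langle w,z-\omega\rangle\le\varepsilon\|z-\omega\|$ for all $z\in\Omega\cap\mathbb{B}_\delta(\omega)$. - The limiting normal cone $N_\Omega(\omega)$ is the set of $w$ for which there exist $\omega_k\to\omega$ with $\omega_k\in\Omega$ and $w_k\in\hat N_\Omega(\omega_k)$ with $w_k\to w$. - The Clarke normal cone is $N^{\mathrm C}_\Omega(\omega)=\operatorname{cl}\operatorname{conv}N_\Omega(\omega)$. Subdifferentials. The limiting subdifferential is $\partial f(x)=\{v\in\mathbb{R}^n:(v,-1)\in N_{\operatorname{epi}f}(x,f(x))\}$ and the Clarke subdifferential is $\partial^{\mathrm C}f(x)=\{v\in\mathbb{R}^n:(v,-1)\in N^{\mathrm C}_{\operatorname{epi}f}(x,f(x))\}$. $\operatorname{dom}\partial f=\{x:\partial f(x)\ne\emptyset\}$. Clarke super-regularity. A set $\Omega$ is Clarke super-regular at $\bar\omega\in\Omega$ if it is locally closed at $\bar\omega$ and for every $\varepsilon>0$ there exists $\delta>0$ such that for every $\hat\omega\in\Omega\cap\mathbb{B}_\delta(\bar\omega)$ and $\hat\omega^*\in N^{\mathrm C}_\Omega(\hat\omega)$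 one has $\langle\hat\omega^*,\omega-\hat\omega\rangle\le\varepsilon\|\hat\omega^*\|\,\|\omega-\hat\omega\|$ for all $\omega\in\Omega\cap\mathbb{B}_\delta(\bar\omega)$. Approximate convexity. $f$ is approximately convex at $\bar x$ if for every $\varepsilon>0$ there exists $\delta>0$ such that for all $x,y\in\mathbb{B}_\delta(\bar x)$ and all $t\in(0,1)$, $f(tx+(1-t)y)\le tf(x)+(1-t)f(y)+\varepsilon t(1-t)\|x-y\|$. *)

(* Defs.v *)
From HB Require Import structures.
From mathcomp Require Import all_boot all_order all_algebra.
From mathcomp Require Import all_classical all_reals all_analysis.

Set Implicit Arguments.
Unset Strict Implicit.
Unset Printing Implicit Defensive.

Import Order.TTheory GRing.Theory Num.Theory.
Import numFieldNormedType.Exports.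

Local Open Scope classical_set_scope.
Local Open Scope ring_scope.

(* R^m is 'rV[R]_m.  The library norm `|_| on 'rV[R]_m is the sup norm, so the
   Euclidean norm and its closed balls are defined here.  Convergence, closure
   and closedness are those of the library topology of 'rV[R]_m, which is the
   Euclidean topology. *)

Section Euclidean.
Context {R : realType} {m : nat}.
Implicit Types (u v w z : 'rV[R]_m) (A Omega : set 'rV[R]_m).

Definition dot u v : R := \sum_(i < m) u 0 i * v 0 i.

Definition enorm u : R := Num.sqrt (dot u u).

Definition eball w (r : R) : set 'rV[R]_m := [set z | enorm (z - w) <= r].

Definition convex_hull A : set 'rV[R]_m :=
  smallest (@convex_set R 'rV[R]_m) A.

Definition frechet_normal Omega w : set 'rV[R]_m :=
  [set v | forall eps : R, 0 < eps -> exists2 delta : R, 0 < delta &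
     forall z, (Omega `&` eball w delta) z ->
       dot v (z - w) <= eps * enorm (z - w)].

Definition limiting_normal Omega w : set 'rV[R]_m :=
  [set v | exists w_ v_ : nat -> 'rV[R]_m,
     [/\ forall k, Omega (w_ k),
         forall k, frechet_normal Omega (w_ k) (v_ k),
         w_ @ \oo --> w &
         v_ @ \oo --> v]].

Definition clarke_normal Omega w : set 'rV[R]_m :=
  closure (convex_hull (limiting_normal Omega w)).

Definition locally_closed_at Omega w : Prop :=
  exists2 r : R, 0 < r & closed (Omega `&` eball w r).

Definition clarke_super_regular Omega w : Prop :=
  [/\ Omega w,
      locally_closed_at Omega w &
      forall eps : R, 0 < eps -> exists2 delta : R, 0 < delta &
        forall w' v, (Omega `&` eball w delta) w' -> clarke_normal Omega w' v ->
          forall z, (Omega `&` eball w delta) z ->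
            dot v (z - w') <= eps * enorm v * enorm (z - w')].

End Euclidean.

Section Functions.
Context {R : realType} {n : nat}.
Implicit Types (f : 'rV[R]_n -> R) (x y v : 'rV[R]_n) (a : R).

(* The pair (x, a) of R^n x R, with R^n x R identified isometrically with
   R^(n + 1). *)
Definition epair x a : 'rV[R]_(n + 1) := row_mx x a%:M.

Definition epi f : set 'rV[R]_(n + 1) :=
  [set w | exists x a, f x <= a /\ w = epair x a].

Definition limiting_subdiff f x : set 'rV[R]_n :=
  [set v | limiting_normal (epi f) (epair x (f x)) (epair v (-1))].

Definition clarke_subdiff f x : set 'rV[R]_n :=
  [set v | clarke_normal (epi f) (epair x (f x)) (epair v (-1))].

Definition locally_lipschitz f : Prop :=
  forall x, exists2 r : R, 0 < r & exists L : R,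
    forall y z, eball x r y -> eball x r z -> `|f y - f z| <= L * enorm (y - z).

Definition approx_convex f (xbar : 'rV[R]_n) : Prop :=
  forall eps : R, 0 < eps -> exists2 delta : R, 0 < delta &
    forall x y (t : R), eball xbar delta x -> eball xbar delta y -> 0 < t < 1 ->
      f (t *: x + (1 - t) *: y) <=
        t * f x + (1 - t) * f y + eps * t * (1 - t) * enorm (x - y).

Definition sdom (T : 'rV[R]_n -> set 'rV[R]_n) : set 'rV[R]_n :=
  [set x | T x !=set0].

Definition submonotone (T : 'rV[R]_n -> set 'rV[R]_n) (xbar : 'rV[R]_n) :
    Prop :=
  forall eps : R, 0 < eps -> exists2 delta : R, 0 < delta &
    forall x1 x2, (eball xbar delta `&` sdom T) x1 ->
      (eball xbar delta `&` sdom T) x2 ->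
      forall v1 v2, T x1 v1 -> T x2 v2 ->
        dot (v1 - v2) (x1 - x2) >= - eps * enorm (x1 - x2).

End Functions.

(* Main.v *)
Require Import Defs.
From HB Require Import structures.
From mathcomp Require Import all_boot all_order all_algebra ring lra.
From mathcomp Require Import all_classical all_reals all_analysis.

(** Two facts carry the proof.

    From approximate convexity to normals. If [f] is approximately convex, then
    from every point [(x, a)] of its epigraph the whole segment towards
    [(y, b + eps |y - x|)] stays in the epigraph whenever [(y, b)] is in it, for
    [x] and [y] near the reference point. A Frechet normal at [(x, a)] is polar
    to that direction. The resulting inequality is linear in the normal and
    continuous in the base point, so it passes to limiting normals and to their
    closed convex hull ([clarke_normal_epi_le]). For normals [(v, -1)] at graph
    points it is the subgradient inequality (iii); for all normals it is
    super-regularity (i).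

    From subgradients to approximate convexity. Minimizing [f] with a quadratic
    penalty around a segment yields Frechet subgradients with a controlled slope
    along the segment at points arbitrarily close to it
    ([penalized_frechet_subgradient]). For a segment reduced to one point this
    says that Frechet subgradients exist on a dense set; there the subgradient
    inequality towards the two ends of a segment implies approximate convexity.
    For a genuine segment it is a mean value theorem, by which submonotonicity
    implies the subgradient inequality for Frechet subgradients.

    The inequality (iii) restricted to Frechet subgradients is thus the hub: it
    follows from (i), because Frechet subgradients of a Lipschitz function are
    bounded by the Lipschitz constant, and from (iv) by the mean value theorem;
    it implies (ii), and (ii) implies (i) and (iii). Finally (iii) gives (iv) on
    adding the inequalities for two points taken in both orders. *)

Import Order.TTheory GRing.Theory Num.Theory.
Import numFieldNormedType.Exports.

Local Open Scope classical_set_scope.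
Local Open Scope ring_scope.

(** * Euclidean norm and inner product *)

Section EuclideanAlgebra.
Context {R : realType} {m : nat}.
Implicit Types (u v w : 'rV[R]_m) (a : R).

Lemma dotC u v : dot u v = dot v u.
Proof. by apply: eq_bigr => i _; rewrite mulrC. Qed.

Lemma dotDl u v w : dot (u + v) w = dot u w + dot v w.
Proof.
by rewrite /dot -big_split; apply: eq_bigr => i _; rewrite mxE mulrDl.
Qed.

Lemma dotZl a u w : dot (a *: u) w = a * dot u w.
Proof. by rewrite /dot mulr_sumr; apply: eq_bigr => i _; rewrite mxE mulrA. Qed.

Lemma dotDr u v w : dot w (u + v) = dot w u + dot w v.
Proof. by rewrite dotC dotDl !(dotC w). Qed.

Lemma dotZr a u w : dot w (a *: u) = a * dot w u.
Proof. by rewrite dotC dotZl (dotC w). Qed.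

Lemma dotNl u w : dot (- u) w = - dot u w.
Proof. by rewrite -scaleN1r dotZl mulN1r. Qed.

Lemma dotNr u w : dot w (- u) = - dot w u.
Proof. by rewrite dotC dotNl (dotC w). Qed.

Definition dotE := (dotDl, dotDr, dotZl, dotZr, dotNl, dotNr).

Lemma dot_ge0 u : 0 <= dot u u.
Proof. by apply: sumr_ge0 => i _; rewrite -expr2 sqr_ge0. Qed.

Lemma enorm_ge0 u : 0 <= enorm u.
Proof. exact: sqrtr_ge0. Qed.

Lemma enorm_sqr u : enorm u ^+ 2 = dot u u.
Proof. by rewrite sqr_sqrtr// dot_ge0. Qed.

Lemma le_enorm u a : 0 <= a -> (enorm u <= a) = (dot u u <= a ^+ 2).
Proof. by move=> a0; rewrite -enorm_sqr ler_pXn2r// nnegrE enorm_ge0. Qed.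

Lemma enorm0 : enorm (0 : 'rV[R]_m) = 0.
Proof. by rewrite /enorm /dot big1 ?sqrtr0// => i _; rewrite mxE mul0r. Qed.

Lemma normr_coord_le_enorm u i : `|u 0 i| <= enorm u.
Proof.
rewrite -sqrtr_sqr ler_sqrt ?dot_ge0// /dot (bigD1 i)//= -expr2 lerDl.
by apply: sumr_ge0 => j _; rewrite -expr2 sqr_ge0.
Qed.

Lemma enorm_eq0 u : enorm u = 0 -> u = 0.
Proof.
move=> u0; apply/rowP => i; rewrite mxE; apply/eqP.
by rewrite -normr_le0 -u0 normr_coord_le_enorm.
Qed.

(** Expand the square norm of [|v| u - |u| v], which is nonnegative, and divide
    by [2 |u| |v|]. *)
Lemma cauchy_schwarz u v : dot u v <= enorm u * enorm v.
Proof.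
have [u0|u0] := eqVneq (enorm u) 0.
  by rewrite (enorm_eq0 u u0) enorm0 -(scale0r 0) dotZl !mul0r.
have [v0|v0] := eqVneq (enorm v) 0.
  by rewrite (enorm_eq0 v v0) enorm0 -(scale0r 0) dotZr mul0r mulr0.
have uv : 0 < enorm u * enorm v.
  by rewrite mulr_gt0// lt_neqAle enorm_ge0 eq_sym ?u0 ?v0.
have := dot_ge0 (enorm v *: u - enorm u *: v).
rewrite !dotE -!enorm_sqr (dotC v u) => H.
have {}H : 0 <= (enorm u * enorm v) * (enorm u * enorm v - dot u v) by nra.
by rewrite -subr_ge0 -(pmulr_rge0 _ uv).
Qed.

Lemma enormZ a u : enorm (a *: u) = `|a| * enorm u.
Proof. by rewrite /enorm !dotE mulrA -expr2 sqrtrM ?sqr_ge0// sqrtr_sqr. Qed.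

Lemma enormN u : enorm (- u) = enorm u.
Proof. by rewrite -scaleN1r enormZ normrN1 mul1r. Qed.

Lemma enormB u v : enorm (u - v) = enorm (v - u).
Proof. by rewrite -enormN opprB. Qed.

Lemma enormD u v : enorm (u + v) <= enorm u + enorm v.
Proof.
rewrite le_enorm ?addr_ge0 ?enorm_ge0// !dotE (dotC v u) -!enorm_sqr.
have := cauchy_schwarz u v; nra.
Qed.

Lemma enorm_dist_trans v u w : enorm (u - w) <= enorm (u - v) + enorm (v - w).
Proof. by apply: le_trans (enormD _ _); rewrite addrA subrK. Qed.

Lemma dist_enorm u v : `|enorm u - enorm v| <= enorm (u - v).
Proof.
have := enormD (u - v) v; have := enormD (v - u) u.
by rewrite !subrK enormB ler_norml; lra.
Qed.

End EuclideanAlgebra.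

Section Pairs.
Context {R : realType} {n : nat}.
Implicit Types (x y v : 'rV[R]_n) (a b : R).

Lemma dot_epair x a y b : dot (epair x a) (epair y b) = dot x y + a * b.
Proof.
rewrite /dot /epair big_split_ord/= big_ord1; congr (_ + _).
  by apply: eq_bigr => i _; rewrite !row_mxEl.
by rewrite !row_mxEr !mxE eqxx.
Qed.

Lemma epairB x a y b : epair x a - epair y b = epair (x - y) (a - b).
Proof. by rewrite /epair opp_row_mx add_row_mx raddfB. Qed.

Lemma epairP (w : 'rV[R]_(n + 1)) : w = epair (lsubmx w) (w 0 (rshift n 0)).
Proof.
by rewrite -{1}(hsubmxK w) /epair [rsubmx w]mx11_scalar !mxE.
Qed.

Lemma enorm_epair_ge x a : enorm x <= enorm (epair x a).
Proof.
by rewrite ler_sqrt ?dot_ge0// dot_epair lerDl -expr2 sqr_ge0.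
Qed.

Lemma normr_epair_ge x a : `|a| <= enorm (epair x a).
Proof.
by rewrite -sqrtr_sqr ler_sqrt ?dot_ge0// dot_epair -expr2 lerDr dot_ge0.
Qed.

Lemma enorm_epair_le x a : enorm (epair x a) <= enorm x + `|a|.
Proof.
rewrite le_enorm ?addr_ge0 ?enorm_ge0// dot_epair -enorm_sqr.
have := enorm_ge0 x; have := normr_ge0 a; have := real_normK (num_real a).
nra.
Qed.

End Pairs.

(** * Euclidean topology *)

Section EuclideanTopology.
Context {R : realType}.

Lemma dot_cvg {m : nat} {T : Type} {F : set_system T} {FF : Filter F}
    {u_ v_ : T -> 'rV[R]_m} {u v : 'rV[R]_m} :
  u_ @ F --> u -> v_ @ F --> v -> dot (u_ k) (v_ k) @[k --> F] --> dot u v.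
Proof.
move=> uu vv; apply: cvg_big => [|i _]; first exact: add_continuous.
have coord (w : 'rV[R]_m) : (fun z : 'rV[R]_m => z 0 i) @ w --> w 0 i.
  exact: (@coord_continuous R 1 m 0 i).
by apply: cvgM; apply: (cvg_comp _ _ _ (coord _)).
Qed.

Lemma enorm_cvg {m : nat} {T : Type} {F : set_system T} {FF : Filter F}
    {u_ : T -> 'rV[R]_m} {u : 'rV[R]_m} :
  u_ @ F --> u -> enorm (u_ k) @[k --> F] --> enorm u.
Proof.
move=> uu; apply: (cvg_comp (fun k => dot (u_ k) (u_ k)) (@Num.sqrt R)).
  exact: (dot_cvg uu uu).
exact: sqrt_continuous.
Qed.

Lemma enorm_sub_cvg {m : nat} (x z : 'rV[R]_m) :
  enorm (y - x) @[y --> z] --> enorm (z - x).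
Proof.
have zx : (fun y : 'rV[R]_m => y - x) @ z --> z - x.
  exact: (@cvgB R 'rV[R]_m _ (nbhs z) _ id (cst x) z x (@cvg_id _ (nbhs z))
    (@cvg_cst _ x _ (nbhs z) _)).
exact: (enorm_cvg zx).
Qed.

Lemma eball_nbhs (m : nat) (x : 'rV[R]_m) (r : R) : 0 < r -> nbhs x (eball x r).
Proof.
move=> r0.
have : enorm (z - x) @[z --> x] --> enorm (x - x) by exact: enorm_sub_cvg.
by rewrite subrr enorm0 => /cvgr_le; apply.
Qed.

(** The bridge from Euclidean estimates to the topology of the sup norm: only
    one centre per estimate is involved, which suits functions such as
    [z |-> |y - z|] as well as locally Lipschitz ones. *)
Lemma continuous_of_enorm_le (m : nat) (g : 'rV[R]_m -> R) :
  (forall x, exists2 r : R, 0 < r & exists L : R,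
    forall y, eball x r y -> `|g y - g x| <= L * enorm (y - x)) ->
  continuous g.
Proof.
move=> gL x; have [r r0 [L gx]] := gL x.
apply/(@cvgrPdist_le R R 'rV[R]_m (nbhs x) (nbhs_filter x)) => eps eps0.
have e0 : 0 < eps / (`|L| + 1) by rewrite divr_gt0// ltr_wpDl.
apply: (@filterS _ (nbhs x) (nbhs_filter x) _ _ _
  (filterI (eball_nbhs m x r r0) (eball_nbhs m x _ e0))) => y [yr ye].
rewrite distrC (le_trans (gx y yr))//.
have := enorm_ge0 (y - x); move: ye; rewrite /eball /= ler_pdivlMr ?ltr_wpDl//.
have := ler_norm L; nra.
Qed.

Lemma eball_compact (m : nat) (w : 'rV[R]_m) (r : R) : compact (eball w r).
Proof.
have ballcl : closed (eball w r).
  rewrite (_ : eball w r = (fun z => enorm (z - w)) @^-1` [set a | a <= r])//.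
  apply: preimage_closed; last exact: closed_le.
  by move=> z _; exact: enorm_sub_cvg.
apply: (subclosed_compact ballcl (B :=
  [set v : 'rV[R]_m | forall i, `[w 0 i - r, w 0 i + r]%classic (v ord0 i)])).
- apply: (@rV_compact _ _ (fun i => `[w 0 i - r, w 0 i + r]%classic)) => i.
  exact: segment_compact.
- move=> z zr i /=; rewrite in_itv/= -ler_distl distrC.
  have := normr_coord_le_enorm (z - w) i; rewrite !mxE distrC.
  move=> /le_trans; apply.
  exact: zr.
Qed.

(** A closed half-space is closed and convex, so a linear inequality satisfied
    by the limiting normals survives the closed convex hull. *)
Lemma clarke_normal_halfspace (m : nat) (Omega : set 'rV[R]_m)
    (w c : 'rV[R]_m) :
  (forall v, limiting_normal Omega w v -> dot v c <= 0) ->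
  forall v, clarke_normal Omega w v -> dot v c <= 0.
Proof.
move=> lim_le v; pose H := [set u : 'rV[R]_m | dot u c <= 0].
have Hcl : closed H.
  rewrite (_ : H = (fun u => dot u c) @^-1` [set a | a <= 0])//.
  apply: preimage_closed; last exact: closed_le.
  move=> u _.
  exact: (dot_cvg (@cvg_id _ (nbhs u)) (@cvg_cst _ c _ (nbhs u) _)).
suff sub : convex_hull (limiting_normal Omega w) `<=` H.
  by move=> /(closureS sub); rewrite -(closure_id H).1.
apply: smallest_sub => // x y t; rewrite !inE /H/= => xc yc.
suff : dot (t%:num *: (x : 'rV[R]_m) + (1 - t%:num) *: (y : 'rV[R]_m)) c <= 0.
  by [].
rewrite !dotE.
have t0 : 0 <= t%:num by [].
have t1 : 0 <= 1 - t%:num by rewrite subr_ge0.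
nra.
Qed.

End EuclideanTopology.

(** * Normal cones *)

Section NormalCones.
Context {R : realType} {m : nat}.
Implicit Types (Omega : set 'rV[R]_m) (v w c : 'rV[R]_m).

Lemma frechet_normal_limiting Omega w : Omega w ->
  frechet_normal Omega w `<=` limiting_normal Omega w.
Proof.
move=> Ow v vN; exists (fun=> w), (fun=> v); split => //; exact: cvg_cst.
Qed.

Lemma limiting_normal_clarke Omega w :
  limiting_normal Omega w `<=` clarke_normal Omega w.
Proof. by move=> v vN; apply: subset_closure; exact: sub_gen_smallest. Qed.

(** A Frechet normal makes no acute angle with a direction along which one can
    move without leaving the set: apply the definition to [w + t c] and divide
    by [t]. *)
Lemma frechet_normal_polar Omega w v c :
    (forall t : R, 0 < t < 1 -> Omega (w + t *: c)) ->
  frechet_normal Omega w v -> dot v c <= 0.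
Proof.
move=> feas vN; apply/ler_addgt0Pr => e e0; rewrite add0r.
have c1 : 0 < enorm c + 1 by rewrite ltr_wpDl ?enorm_ge0.
have [d d0 vd] := vN (e / (enorm c + 1)) (divr_gt0 e0 c1).
pose t := Num.min (1 / 2) (d / (enorm c + 1)).
have t0 : 0 < t by rewrite lt_min divr_gt0//= divr_gt0.
have t1 : t <= 1 / 2 by rewrite ge_min lexx.
have td : t * (enorm c + 1) <= d.
  by rewrite -ler_pdivlMr// ge_min lexx orbT.
have := vd (w + t *: c).
rewrite addrAC subrr add0r enormZ dotZr gtr0_norm// mulrCA ler_pM2l//.
rewrite mulrAC ler_pdivlMr// => H.
have e_c : dot v c * (enorm c + 1) <= e * enorm c.
  apply: H; split; first by apply: feas; lra.
  rewrite /eball/= addrAC subrr add0r enormZ gtr0_norm//.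
  by apply: le_trans td; rewrite ler_pM2l// lerDl.
by rewrite -(ler_pM2r c1) (le_trans e_c)// ler_pM2l// lerDl.
Qed.

End NormalCones.

(** * Epigraphs and Frechet subgradients of Lipschitz functions *)

Section Epigraphs.
Context {R : realType} {n : nat}.
Implicit Types (f : 'rV[R]_n -> R) (x y z v : 'rV[R]_n) (a b L r : R).

Definition frechet_subdiff f x : set 'rV[R]_n :=
  [set v | frechet_normal (epi f) (epair x (f x)) (epair v (-1))].

Lemma epi_epair f x a : epi f (epair x a) <-> f x <= a.
Proof.
split; last by exists x, a.
move=> [y [b [fyb /eq_row_mx[-> /matrixP/(_ 0 0)]]]].
by rewrite !mxE eqxx !mulr1n => ->.
Qed.

Lemma frechet_subdiff_limiting f x :
  frechet_subdiff f x `<=` limiting_subdiff f x.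
Proof. by move=> v; apply: frechet_normal_limiting; apply/epi_epair. Qed.

Lemma limiting_subdiff_clarke f x :
  limiting_subdiff f x `<=` clarke_subdiff f x.
Proof. by move=> v; exact: limiting_normal_clarke. Qed.

(** A function lying locally above a downward paraboloid with slope [v] at [x]
    has [v] as a Frechet subgradient: the quadratic defect is absorbed in
    [e |z - x|] once [|z - x| <= e / (k + 1)]. Minimizers of [f] plus a
    quadratic penalty produce subgradients in this way. *)
Lemma proximal_frechet_subdiff f x v r k : 0 < r -> 0 <= k ->
    (forall y, eball x r y ->
       f x + dot v (y - x) - k * enorm (y - x) ^+ 2 <= f y) ->
  frechet_subdiff f x v.
Proof.
move=> r0 k0 H e e0; have k1 : 0 < k + 1 by rewrite ltr_wpDl.
exists (Num.min r (e / (k + 1))); first by rewrite lt_min r0 divr_gt0.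
move=> _ [[y [b [fyb ->]]]]; rewrite /eball /= epairB dot_epair le_min.
rewrite ler_pdivlMr// => /andP[zr ze].
have yz := enorm_epair_ge (y - x) (b - f x).
have := H y (le_trans yz zr); have := enorm_ge0 (y - x).
set E := enorm (epair _ _) in zr ze yz *; move=> y0.
have : enorm (y - x) ^+ 2 <= E ^+ 2 by rewrite ler_pXn2r// nnegrE//; lra.
nra.
Qed.

(** Testing the normality inequality at [x + h v / |v|], on the graph of [f],
    bounds [h |v|] by [L h] up to an arbitrarily small multiple of [h]. *)
Lemma frechet_subdiff_lipschitz f x v r L : 0 < r -> 0 <= L ->
    (forall y, eball x r y -> `|f y - f x| <= L * enorm (y - x)) ->
  frechet_subdiff f x v -> enorm v <= L.
Proof.
move=> r0 L0 fL vF; have [v0|v0] := eqVneq (enorm v) 0; first by rewrite v0.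
have {}v0 : 0 < enorm v by rewrite lt_neqAle enorm_ge0 eq_sym v0.
have L1 : 0 < 1 + L by lra.
apply/ler_addgt0Pr => e e0.
have [d d0 vd] := vF (e / (1 + L)) (divr_gt0 e0 L1).
(* The graph point above [x + h v / |v|] is at distance at most [h (1 + L)]. *)
pose h := Num.min r (d / (1 + L)).
have h0 : 0 < h by rewrite lt_min r0 divr_gt0.
have hr : h <= r by rewrite ge_min lexx.
have hd : h * (1 + L) <= d by rewrite -ler_pdivlMr// ge_min lexx orbT.
pose y := x + (h / enorm v) *: v.
have yx : y - x = (h / enorm v) *: v by rewrite /y addrAC subrr add0r.
have nyx : enorm (y - x) = h.
  by rewrite yx enormZ ger0_norm ?divr_ge0 ?ltW// divfK ?gt_eqF.
have fy := fL y; rewrite /eball /= nyx in fy; move/(_ hr) : fy => fy.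
have pairle : enorm (epair (y - x) (f y - f x)) <= h * (1 + L).
  by apply: le_trans (enorm_epair_le _ _) _; rewrite nyx; lra.
have := vd (epair y (f y)); rewrite /eball /= epairB => H.
have {H} : dot (epair v (-1)) (epair (y - x) (f y - f x)) <= e * h.
  apply: (le_trans (H _)).
    by split; [apply/epi_epair|exact: le_trans pairle hd].
  rewrite -mulrA ler_pM2l// mulrC ler_pdivrMr//.
rewrite dot_epair yx dotZr -enorm_sqr.
rewrite (_ : h / enorm v * enorm v ^+ 2 = h * enorm v); last first.
  by field; rewrite gt_eqF.
move: fy; rewrite ler_norml => /andP[_ fy] H.
rewrite -(ler_pM2l h0); lra.
Qed.

Lemma locally_lipschitz_at f x : locally_lipschitz f ->
  exists r L, [/\ 0 < r, 0 <= L & forall y z, eball x r y -> eball x r z ->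
    `|f y - f z| <= L * enorm (y - z)].
Proof.
move=> /(_ x)[r r0 [L fL]]; exists r, `|L|; split => // y z yr zr.
by rewrite (le_trans (fL y z yr zr))// ler_wpM2r ?enorm_ge0 ?ler_norm.
Qed.

Lemma locally_lipschitz_center f : locally_lipschitz f ->
  forall x, exists2 r : R, 0 < r & exists L : R,
    forall y, eball x r y -> `|f y - f x| <= L * enorm (y - x).
Proof.
move=> flip x; have [r [L [r0 _ fL]]] := locally_lipschitz_at f x flip.
exists r => //; exists L => y yr; apply: fL => //.
by rewrite /eball /= subrr enorm0 ltW.
Qed.

Lemma locally_lipschitz_continuous f : locally_lipschitz f -> continuous f.
Proof.
by move=> flip; exact/continuous_of_enorm_le/locally_lipschitz_center.
Qed.

Lemma enorm_lsubmx (w : 'rV[R]_(n + 1)) : enorm (lsubmx w) <= enorm w.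
Proof. by rewrite [in leRHS](epairP w) enorm_epair_ge. Qed.

Lemma continuous_lsubmx_comp (g : 'rV[R]_n -> R) :
    (forall x, exists2 r : R, 0 < r & exists L : R,
      forall y, eball x r y -> `|g y - g x| <= L * enorm (y - x)) ->
  continuous (fun w : 'rV[R]_(n + 1) => g (lsubmx w)).
Proof.
move=> gL; apply: continuous_of_enorm_le => w.
have [r r0 [L gw]] := gL (lsubmx w); exists r => //; exists `|L| => z zr.
have zw : enorm (lsubmx z - lsubmx w) <= enorm (z - w).
  by rewrite -raddfB enorm_lsubmx.
apply: (le_trans (gw _ (le_trans zw zr))).
apply: (le_trans (ler_wpM2r (enorm_ge0 _) (ler_norm L))).
by rewrite ler_wpM2l.
Qed.

Lemma epi_closed f : locally_lipschitz f -> closed (epi f).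
Proof.
move=> flip.
pose g (w : 'rV[R]_(n + 1)) : R := w 0 (rshift n 0) - f (lsubmx w).
rewrite (_ : epi f = g @^-1` [set a | 0 <= a]); last first.
  by apply/seteqP; split => w; rewrite [w]epairP epi_epair /g /= /epair
    row_mxKl row_mxEr !mxE eqxx mulr1n subr_ge0.
apply: preimage_closed; last exact: closed_ge.
move=> w _; apply: (@cvgB R R 'rV[R]_(n + 1) (nbhs w)).
  exact: coord_continuous.
exact/continuous_lsubmx_comp/locally_lipschitz_center.
Qed.

End Epigraphs.

(** * Penalized minimization along a segment *)

Section PenalizedMinimization.
Context {R : realType} {n : nat}.
Implicit Types (f : 'rV[R]_n -> R) (x y z v : 'rV[R]_n) (L r d k s t : R).

Lemma eball_segment (xbar x y : 'rV[R]_n) r t :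
  eball xbar r x -> eball xbar r y -> 0 <= t <= 1 ->
  eball xbar r (x + t *: (y - x)).
Proof.
rewrite /eball /= => xr yr /andP[t0 t1].
have -> : x + t *: (y - x) - xbar = (1 - t) *: (x - xbar) + t *: (y - xbar).
  by apply/rowP => i; rewrite !mxE; ring.
apply: (le_trans (enormD _ _)); rewrite !enormZ !ger0_norm//; last lra.
nra.
Qed.

(** Joint minimization over points and parameters of
    [f z - s t + k |z - (x + t (y - x))|^2]: the penalty replaces the constraint
    that [z] lie on the segment. Comparing the minimizer with the segment point
    of the same parameter gives [k E^2 <= L E], where [E] is the distance from
    [z] to that point, hence the bound [L / k]. *)
Lemma penalized_minimizer f (xbar x y : 'rV[R]_n) r L k s :
    continuous f -> 0 < k -> 0 <= L ->
    (forall u v, eball xbar r u -> eball xbar r v ->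
       `|f u - f v| <= L * enorm (u - v)) ->
    eball xbar r x -> eball xbar r y ->
  exists z t, [/\ eball xbar r z, 0 <= t <= 1,
    enorm (z - (x + t *: (y - x))) <= L / k &
    forall z' t', eball xbar r z' -> 0 <= t' <= 1 ->
      f z - s * t + k * enorm (z - (x + t *: (y - x))) ^+ 2 <=
      f z' - s * t' + k * enorm (z' - (x + t' *: (y - x))) ^+ 2].
Proof.
move=> fcont k0 L0 fL xr yr.
pose F (p : 'rV[R]_n * R) : R :=
  f p.1 - s * p.2 + k * enorm (p.1 - (x + p.2 *: (y - x))) ^+ 2.
have Fcont : continuous F.
  move=> p.
  have c1 : q.1 @[q --> p] --> p.1 by exact: cvg_fst.
  have c2 : q.2 @[q --> p] --> p.2 by exact: cvg_snd.
  apply: (@cvgD R R _ (nbhs p)).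
    apply: (@cvgB R R _ (nbhs p)).
      exact: (cvg_comp _ _ c1 (fcont p.1)).
    by apply: (@cvgM R _ (nbhs p)); [exact: cvg_cst|].
  apply: (@cvgM R _ (nbhs p)); first exact: cvg_cst.
  have E : enorm (q.1 - (x + q.2 *: (y - x))) @[q --> p] -->
           enorm (p.1 - (x + p.2 *: (y - x))).
    have c3 : (x + q.2 *: (y - x)) @[q --> p] --> x + p.2 *: (y - x).
      apply: (@cvgD R 'rV[R]_n _ (nbhs p) _ (cst x)); first exact: cvg_cst.
      exact: (@cvgZr_tmp R 'rV[R]_n _ (nbhs p) _ _ _ _ c2).
    have c4 : (q.1 - (x + q.2 *: (y - x))) @[q --> p] -->
      p.1 - (x + p.2 *: (y - x)) by exact: (@cvgB R 'rV[R]_n _ (nbhs p)).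
    exact: (enorm_cvg c4).
  exact: (@cvgM R _ (nbhs p) _ _ _ _ _ E E).
pose K := eball xbar r `*` (`[(0 : R), 1]%classic : set R).
have Kc : compact K.
  by apply: compact_setX; [exact: eball_compact|exact: segment_compact].
have K0 : K !=set0.
  by exists (x, 0); split => //=; rewrite in_itv/= lexx ler01.
have [[z t]] := compact_EVT_min K0 Kc (continuous_subspaceT Fcont).
rewrite inE /= => -[/= zr]; rewrite in_itv/= => t01 zmin.
exists z, t; split => //.
- have pr := eball_segment _ _ _ _ _ xr yr t01.
  have pK : (x + t *: (y - x), t) \in K.
    by rewrite inE; split => //=; rewrite in_itv.
  have := zmin _ pK; rewrite /F /= subrr enorm0.
  have := fL _ _ pr zr; rewrite enormB ler_norml => /andP[_].
  have := enorm_ge0 (z - (x + t *: (y - x))).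
  set E := enorm _; rewrite ler_pdivlMr// le_eqVlt => /predU1P[<-|E0] H1 H2.
    by rewrite mul0r.
  rewrite -(ler_pM2l E0); nra.
- by move=> z' t' z'r t'01; apply: (zmin (z', t')); rewrite inE.
Qed.

(** An approximate mean value theorem. At a minimizer of the penalized problem,
    optimality in [z] says that [v = 2 k (p - z)] is a Frechet subgradient,
    where [p = x + t (y - x)]; if [t > 0], optimality in [t] against smaller
    parameters says that the slope of [v] along [y - x] is at most [s]. The last
    inequality compares the minimizer with the end point [y], [t = 1]; it serves
    to keep [t] away from 0. With [x = y] the statement gives the density of the
    points having a Frechet subgradient. *)
Lemma penalized_frechet_subgradient f (xbar x y : 'rV[R]_n) r L s e :
    continuous f -> 0 <= L ->
    (forall u v, eball xbar r u -> eball xbar r v ->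
       `|f u - f v| <= L * enorm (u - v)) ->
    eball xbar (r / 2) x -> eball xbar (r / 2) y -> 0 < e -> e <= r / 4 ->
  exists z t v, [/\ 0 <= t <= 1, enorm (z - (x + t *: (y - x))) <= e,
    frechet_subdiff f z v & 0 <= dot v (x + t *: (y - x) - z)] /\
    [/\ 0 < t -> dot v (y - x) <= s & f z - s * t <= f y - s].
Proof.
move=> fcont L0 fL xr yr e0 er.
(* [L + 1] instead of [L] keeps the penalty positive when [L = 0]. *)
pose k := (L + 1) / e; have k0 : 0 < k by rewrite divr_gt0// ltr_wpDl.
have half u : eball xbar (r / 2) u -> eball xbar r u.
  by rewrite /eball /=; lra.
have [z [t [zr t01 zt zmin]]] := penalized_minimizer f xbar x y r L k s
  fcont k0 L0 fL (half x xr) (half y yr).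
have {}zt : enorm (z - (x + t *: (y - x))) <= e.
  apply: (le_trans zt); rewrite ler_pdivrMr// /k mulrC divfK ?gt_eqF//; lra.
pose p := x + t *: (y - x); pose v := (2 * k) *: (p - z).
have pr := eball_segment _ _ _ _ _ xr yr t01.
exists z, t, v; split; [split => //|split].
- apply: (@proximal_frechet_subdiff _ _ _ _ _ (r / 4) k); [lra|lra|].
  move=> z' z'z.
  have z'r : eball xbar r z'.
    rewrite /eball /= in z'z pr *.
    have := enorm_dist_trans z z' xbar.
    have := enorm_dist_trans p z xbar; rewrite -/p in pr zt; lra.
  have := zmin z' t z'r t01; rewrite -/p.
  have -> : z' - p = (z - p) + (z' - z) by rewrite [RHS]addrC addrA subrK.
  rewrite /v -[p - z]opprB; move: (z - p) (z' - z) => a b.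
  rewrite !enorm_sqr !dotE (dotC b a); lra.
- by rewrite -/p /v dotZl mulr_ge0 ?dot_ge0//; lra.
- move=> t0; apply/ler_addgt0Pr => eta eta0.
  set d := y - x; have D0 := dot_ge0 d.
  have q0 : 0 < k * dot d d + 1 by rewrite ltr_wpDl// mulr_ge0// ltW.
  pose h := Num.min t (eta / (k * dot d d + 1)).
  have h0 : 0 < h by rewrite lt_min t0 divr_gt0.
  have ht : h <= t by rewrite ge_min lexx.
  have hq : h * (k * dot d d + 1) <= eta.
    by rewrite -ler_pdivlMr// ge_min lexx orbT.
  have th01 : 0 <= t - h <= 1 by lra.
  have := zmin z (t - h) zr th01; rewrite -/d -/p.
  have -> : z - (x + (t - h) *: d) = (z - p) + h *: d.
    by apply/rowP => i; rewrite /p !mxE; ring.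
  rewrite /v -[p - z]opprB; move: (z - p) => a; clearbody d.
  rewrite !enorm_sqr !dotE (dotC d a) => H.
  rewrite -(ler_pM2l h0); nra.
- have yr' := half y yr.
  have := zmin y 1 yr'; rewrite ler01 lexx => /(_ isT).
  have -> : y - (x + 1 *: (y - x)) = 0.
    by apply/rowP => i; rewrite !mxE; ring.
  rewrite enorm0 -/p => H.
  have : 0 <= k * enorm (z - p) ^+ 2 by rewrite mulr_ge0 ?sqr_ge0// ltW.
  lra.
Qed.

End PenalizedMinimization.

(** * From subgradients to approximate convexity *)

Section Implications.
Context {R : realType} {n : nat}.
Implicit Types (f : 'rV[R]_n -> R) (x y z v xbar : 'rV[R]_n) (a b eps : R).

(** The first-order inequality of assertion (iii), for an arbitrary notion [T]
    of subdifferential: the passage between the four assertions goes through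
    its instance for the Frechet subdifferential. *)
Definition subgradient_ineq (T : 'rV[R]_n -> set 'rV[R]_n) f xbar : Prop :=
  forall eps : R, 0 < eps -> exists2 delta : R, 0 < delta &
    forall x y v, eball xbar delta x -> eball xbar delta y -> T x v ->
      f y - f x >= dot v (y - x) - eps * enorm (y - x).

(** At a Frechet subgradient [v] of a point [z] near [p = t x + (1 - t) y], add
    the inequalities towards [x] and [y] with weights [t] and [1 - t]. The
    linear terms add up to [<v, p - z>], which is nonnegative for the
    subgradients produced by penalization, and
    [t |x - p| + (1 - t) |y - p| = 2 t (1 - t) |x - y|], whence the factor 2 on
    the precision. Finally let [z] tend to [p]. *)
Lemma frechet_subgradient_ineq_approx_convex f xbar : locally_lipschitz f ->
  subgradient_ineq (frechet_subdiff f) f xbar -> approx_convex f xbar.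
Proof.
move=> flip fQ eps eps0.
have [d0 d00 fd] := fQ (eps / 2) (divr_gt0 eps0 (ltr0Sn _ _)).
have [r [L [r0 L0 fL]]] := locally_lipschitz_at f xbar flip.
pose d := Num.min d0 r.
have d0' : 0 < d by rewrite lt_min d00.
have dd0 : d <= d0 by rewrite ge_min lexx.
have dr : d <= r by rewrite ge_min lexx orbT.
have fLd u v : eball xbar d u -> eball xbar d v ->
    `|f u - f v| <= L * enorm (u - v).
  by move=> ud vd; apply: fL; [move: ud|move: vd]; rewrite /eball /=; lra.
exists (d / 2); first lra.
move=> x y t xd yd /andP[t0 t1].
set p := t *: x + (1 - t) *: y.
have t01 : 0 <= 1 - t <= 1 by lra.
have pE : p = x + (1 - t) *: (y - x) by apply/rowP => i; rewrite !mxE; ring.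
have pd : eball xbar (d / 2) p by rewrite pE; exact: eball_segment.
apply/ler_addgt0Pr => eta eta0.
pose e := Num.min (d / 4) (eta / (L + eps + 1)).
have q0 : 0 < L + eps + 1 by lra.
have e0 : 0 < e by rewrite lt_min !divr_gt0.
have ed : e <= d / 4 by rewrite ge_min lexx.
have eeta : e * (L + eps + 1) <= eta by rewrite -ler_pdivlMr// ge_min lexx orbT.
have fcont := locally_lipschitz_continuous f flip.
have [z [s [v [[_ zp vz pv] _]]]] :=
  penalized_frechet_subgradient f xbar p p d L 0 e fcont L0 fLd pd pd e0 ed.
rewrite subrr scaler0 addr0 in zp pv.
have zd : eball xbar d z.
  have := enorm_dist_trans p z xbar; move: pd zp; rewrite /eball /=; lra.
have wide u c : c <= d0 -> eball xbar c u -> eball xbar d0 u.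
  by rewrite /eball /=; lra.
have zd0 := wide z d dd0 zd.
have xd0 : eball xbar d0 x by apply: wide xd; lra.
have yd0 : eball xbar d0 y by apply: wide yd; lra.
have pdd : eball xbar d p by move: pd; rewrite /eball/=; lra.
have fx := fd z x v zd0 xd0 vz.
have fy := fd z y v zd0 yd0 vz.
have fpz := fLd p z pdd zd; rewrite ler_norml enormB in fpz.
case/andP: fpz => _ fpz.
have pvE : dot v (p - z) = t * dot v (x - z) + (1 - t) * dot v (y - z).
  by rewrite -!dotZr -dotDr; congr dot; apply/rowP => i; rewrite !mxE; ring.
have xz : enorm (x - z) <= (1 - t) * enorm (x - y) + e.
  apply: (le_trans (enorm_dist_trans p x z)).
  rewrite (enormB p z) lerD//.
  have -> : x - p = (1 - t) *: (x - y) by apply/rowP => i; rewrite !mxE; ring.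
  by rewrite enormZ ger0_norm//; lra.
have yz : enorm (y - z) <= t * enorm (x - y) + e.
  apply: (le_trans (enorm_dist_trans p y z)).
  rewrite (enormB p z) lerD//.
  have -> : y - p = t *: (y - x) by apply/rowP => i; rewrite !mxE; ring.
  by rewrite enormZ (ger0_norm (ltW t0)) (enormB y).
have tfx : t * (dot v (x - z) - eps / 2 * ((1 - t) * enorm (x - y) + e)) <=
    t * (f x - f z).
  rewrite ler_pM2l// (le_trans _ fx)// lerB// ler_pM2l//; lra.
have tfy : (1 - t) * (dot v (y - z) - eps / 2 * (t * enorm (x - y) + e)) <=
    (1 - t) * (f y - f z).
  rewrite ler_wpM2l//; first lra.
  rewrite (le_trans _ fy)// lerB// ler_pM2l//; lra.
have Le : L * enorm (z - p) <= L * e by rewrite ler_wpM2l.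
have epse : 0 < eps * e by rewrite mulr_gt0.
lra.
Qed.

(** Super-regularity, read at two points of the graph and a normal [(v, -1)],
    is the subgradient inequality up to the norms of [(v, -1)] and of
    [(y - x, f y - f x)]. Since [|v| <= L], these are at most [1 + L] and
    [(1 + L) |y - x|], so precision [eps / (1 + L)^2] suffices. *)
Lemma clarke_super_regular_frechet_subgradient_ineq f xbar :
    locally_lipschitz f ->
  clarke_super_regular (epi f) (epair xbar (f xbar)) ->
  subgradient_ineq (frechet_subdiff f) f xbar.
Proof.
move=> flip [_ _ reg] eps eps0.
have [r [L [r0 L0 fL]]] := locally_lipschitz_at f xbar flip.
have L1 : 0 < 1 + L by lra.
have c0 : 0 < (1 + L) ^+ 2 by rewrite exprn_gt0.
have [d d0 fd] := reg (eps / (1 + L) ^+ 2) (divr_gt0 eps0 c0).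
pose e := Num.min (r / 2) (d / (1 + L)).
have e0 : 0 < e by rewrite lt_min !divr_gt0.
have er : e <= r / 2 by rewrite ge_min lexx.
have ed : e * (1 + L) <= d by rewrite -ler_pdivlMr// ge_min lexx orbT.
have pairle u w : eball xbar r u -> eball xbar r w ->
    enorm (epair (u - w) (f u - f w)) <= (1 + L) * enorm (u - w).
  move=> ur wr; apply: (le_trans (enorm_epair_le _ _)).
  by have := fL u w ur wr; lra.
have xbarr : eball xbar r xbar by rewrite /eball /= subrr enorm0 ltW.
have er' u : eball xbar e u -> eball xbar r u by rewrite /eball /=; lra.
have epid u : eball xbar e u ->
    (epi f `&` eball (epair xbar (f xbar)) d) (epair u (f u)).
  move=> ue; split; first exact/epi_epair.
  rewrite /eball /= epairB (le_trans (pairle u xbar (er' u ue) xbarr))//.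
  rewrite (le_trans _ ed)// mulrC ler_pM2r//; exact: ue.
exists e => // x y v xe ye vx.
have vL : enorm v <= L.
  apply: (@frechet_subdiff_lipschitz _ _ f x v (r / 2)) => //; first lra.
  move=> z zx; apply: fL; last exact: er'.
  have := enorm_dist_trans x z xbar; move: zx xe; rewrite /eball /=; lra.
have vC : clarke_normal (epi f) (epair x (f x)) (epair v (-1)).
  exact/limiting_subdiff_clarke/frechet_subdiff_limiting.
have := fd _ _ (epid x xe) vC _ (epid y ye).
rewrite epairB dot_epair => H.
have pl := pairle y x (er' y ye) (er' x xe).
have vl : enorm (epair v (-1)) <= 1 + L.
  by apply: (le_trans (enorm_epair_le _ _)); rewrite normrN1; lra.
have : eps / (1 + L) ^+ 2 * enorm (epair v (-1)) *
    enorm (epair (y - x) (f y - f x)) <=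
    eps / (1 + L) ^+ 2 * (1 + L) * ((1 + L) * enorm (y - x)).
  have q0 : 0 <= eps / (1 + L) ^+ 2 by rewrite ltW ?divr_gt0.
  apply: ler_pM => //; last exact: ler_wpM2l.
    by rewrite mulr_ge0 ?enorm_ge0.
  exact: enorm_ge0.
rewrite (_ : _ * _ * ((1 + L) * _) = eps * enorm (y - x)); first lra.
by field; rewrite gt_eqF.
Qed.

(** Let [h = y - x]. The mean value theorem applied with a slope [s] slightly
    above [f y - f x] gives [t > 0] and a subgradient [w] at a point
    [z ~ x + t h] such that [<w, h> <= s]. Submonotonicity between [z] and [x]
    gives [t <v, h> <= t <w, h> + t eps |h|] up to an error proportional to
    [|z - (x + t h)|]. As [t] is bounded below independently of that error, one
    may divide by [t] and let the error, then [s - (f y - f x)], tend to 0. *)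
Lemma submonotone_frechet_subgradient_ineq f xbar : locally_lipschitz f ->
  submonotone (limiting_subdiff f) xbar ->
  subgradient_ineq (frechet_subdiff f) f xbar.
Proof.
move=> flip fmon eps eps0.
have [d0 d00 fd] := fmon eps eps0.
have [r [L [r0 L0 fL]]] := locally_lipschitz_at f xbar flip.
pose d := Num.min d0 r.
have d0' : 0 < d by rewrite lt_min d00.
have dd0 : d <= d0 by rewrite ge_min lexx.
have dr : d <= r by rewrite ge_min lexx orbT.
have fLd u v : eball xbar d u -> eball xbar d v ->
    `|f u - f v| <= L * enorm (u - v).
  by move=> ud vd; apply: fL; [move: ud|move: vd]; rewrite /eball /=; lra.
exists (d / 2); first lra.
move=> x y v xd yd vx.
set h := y - x.
suff key eta : 0 < eta -> dot v h - eps * enorm h <= f y - f x + eta.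
  by apply/ler_addgt0Pr => eta eta0; exact: key.
have xdd : eball xbar d x by move: xd; rewrite /eball/=; lra.
have ydd : eball xbar d y by move: yd; rewrite /eball/=; lra.
move=> eta20; pose et := eta / 2; have eta0 : 0 < et by rewrite divr_gt0.
pose s := f y - f x + et.
(* The value [f z - s t] at the minimizer is at most [f x - et], while [f] drops
   by at most [L (t |h| + e)] between [x] and [z]: hence [t M >= et - L e], and
   [tau = et / (2 M)] is a lower bound for [t] when [L e <= et / 2]. *)
pose M := L * enorm h + s.
have M0 : et <= M.
  have := fLd x y xdd ydd; rewrite enormB -/h ler_norml => /andP[_].
  rewrite /M /s; lra.
pose tau := et / (2 * M).
have tau0 : 0 < tau by rewrite divr_gt0//; lra.
have v0 := enorm_ge0 v.
pose e := Num.min (d / 4)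
  (Num.min (et / (2 * (L + 1))) (et * tau / (enorm v + eps))).
have e0 : 0 < e.
  have e1 : 0 < d / 4 by lra.
  have e2 : 0 < et / (2 * (L + 1)) by rewrite divr_gt0//; lra.
  have e3 : 0 < et * tau / (enorm v + eps).
    by apply: divr_gt0; [exact: mulr_gt0|lra].
  by rewrite !lt_min e1 e2 e3.
have ed : e <= d / 4 by rewrite ge_min lexx.
have eL : e * (2 * (L + 1)) <= et.
  by rewrite -ler_pdivlMr; [rewrite !ge_min lexx orbT|lra].
have ev : e * (enorm v + eps) <= et * tau.
  by rewrite -ler_pdivlMr; [rewrite !ge_min lexx !orbT|lra].
have fcont := locally_lipschitz_continuous f flip.
have [z [t [w [[/andP[t0 t1] zp wz pw] [ws fz]]]]] :=
  penalized_frechet_subgradient f xbar x y d L s e fcont L0 fLd xd yd e0 ed.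
rewrite -/h in zp pw ws.
set p := x + t *: h in zp pw.
have pd : eball xbar (d / 2) p by apply: eball_segment => //; rewrite t0.
have zd : eball xbar d z.
  have := enorm_dist_trans p z xbar; move: pd zp; rewrite /eball /=; lra.
have zx : z - x = t *: h + (z - p) by apply/rowP => i; rewrite /p !mxE; ring.
have zxn : enorm (z - x) <= t * enorm h + e.
  by rewrite zx (le_trans (enormD _ _))// enormZ ger0_norm// lerD2l.
have h0 := enorm_ge0 h.
have tM : et / 2 <= t * M.
  have := fLd x z xdd zd; rewrite enormB ler_norml => /andP[_].
  have : L * enorm (z - x) <= L * (t * enorm h + e) by rewrite ler_wpM2l.
  move: fz; rewrite /M /s; lra.
have tt : tau <= t.
  rewrite /tau ler_pdivrMr; lra.
have {}ws := ws (lt_le_trans tau0 tt).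
have zd0 : eball xbar d0 z by move: zd; rewrite /eball/=; lra.
have xd0 : eball xbar d0 x by move: xdd; rewrite /eball/=; lra.
have wzl := frechet_subdiff_limiting _ _ _ wz.
have vxl := frechet_subdiff_limiting _ _ _ vx.
have := fd z x (conj zd0 (ex_intro _ w wzl)) (conj xd0 (ex_intro _ v vxl))
  _ _ wzl vxl.
have vzp : - dot v (z - p) <= enorm v * e.
  rewrite -dotNr (le_trans (cauchy_schwarz _ _))// enormN.
  exact: ler_wpM2l.
have epsn : eps * enorm (z - x) <= eps * (t * enorm h + e) by rewrite ler_pM2l.
have {pw} wzp : dot w (z - p) <= 0.
  by rewrite -oppr_ge0 -dotNr opprB.
rewrite dotDl dotNl {2 3}zx !(dotDr (t *: h)) !dotZr => H.
have tws : t * dot w h <= t * s by rewrite ler_wpM2l.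
have ettau : et * tau <= et * t by rewrite ler_pM2l.
have t_gt0 : 0 < t by lra.
rewrite -(ler_pM2l t_gt0).
have -> : f y - f x + eta = s + et by rewrite /s /et; field.
lra.
Qed.

(** * From approximate convexity to normals *)

(** Approximate convexity says that, from any point [(x, a)] of the epigraph, one
    can move towards [(y, b + eps |y - x|)] without leaving it, for every point
    [(y, b)] of the epigraph with [x] and [y] in the ball where the estimate
    holds; Frechet normals are polar to such directions.
    This treats at once the normals [(v, -1)], the horizontal ones and the
    points strictly above the graph. *)
Lemma frechet_normal_epi_le f xbar delta eps x a y b nu :
    (forall x y (t : R), eball xbar delta x -> eball xbar delta y ->
      0 < t < 1 ->
      f (t *: x + (1 - t) *: y) <=
        t * f x + (1 - t) * f y + eps * t * (1 - t) * enorm (x - y)) ->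
    0 < eps -> eball xbar delta x -> eball xbar delta y ->
    f x <= a -> f y <= b ->
  frechet_normal (epi f) (epair x a) nu ->
  dot nu (epair (y - x) (b - a + eps * enorm (y - x))) <= 0.
Proof.
move=> fac eps0 xd yd fxa fyb; apply: frechet_normal_polar => t t01.
have -> : epair x a + t *: epair (y - x) (b - a + eps * enorm (y - x)) =
    epair (t *: y + (1 - t) *: x)
      (t * b + (1 - t) * a + t * (eps * enorm (y - x))).
  rewrite /epair scale_row_mx add_row_mx; congr row_mx.
    by apply/rowP => i; rewrite !mxE; ring.
  by apply/matrixP => i j; rewrite !mxE (ord1 i) (ord1 j) eqxx !mulr1n; ring.
apply/epi_epair; apply: (le_trans (fac y x t yd xd t01)).
case/andP: t01 => t0 t1.
have tb : t * f y <= t * b by rewrite ler_pM2l.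
have ta : (1 - t) * f x <= (1 - t) * a by rewrite ler_pM2l// subr_gt0.
have te : 0 <= (eps * t * t) * enorm (y - x).
  by rewrite !mulr_ge0 ?enorm_ge0// ltW.
lra.
Qed.

(** The inequality for Frechet normals is continuous in the normal and in its
    base point, and linear in the normal, so it holds for limiting and then for
    Clarke normals. The ball around [xbar] is halved so that the base points of
    an approximating sequence eventually lie in the larger one. *)
Lemma clarke_normal_epi_le f xbar delta eps x a y b nu :
    (forall x y (t : R), eball xbar delta x -> eball xbar delta y ->
      0 < t < 1 ->
      f (t *: x + (1 - t) *: y) <=
        t * f x + (1 - t) * f y + eps * t * (1 - t) * enorm (x - y)) ->
    0 < eps -> 0 < delta ->
    eball xbar (delta / 2) x -> eball xbar delta y -> f y <= b ->
  clarke_normal (epi f) (epair x a) nu ->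
  dot nu (epair (y - x) (b - a + eps * enorm (y - x))) <= 0.
Proof.
move=> fac eps0 delta0 xd yd fyb; apply: clarke_normal_halfspace => {}nu.
move=> [w_ [nu_ [epiw frw wlim nulim]]].
pose c (w : 'rV[R]_(n + 1)) := epair (y - lsubmx w)
  (b - w 0 (rshift n 0) + eps * enorm (y - lsubmx w)).
(* In this form the continuity of [c] is that of sums and products. *)
have cE w : c w = (epair y b - w) +
    (eps * enorm (y - lsubmx w)) *: epair 0 1.
  have -> : epair y b - w = epair (y - lsubmx w) (b - w 0 (rshift n 0)).
    by rewrite -epairB -epairP.
  rewrite /c /epair scale_row_mx add_row_mx scaler0.
  rewrite addr0; congr row_mx.
  by apply/matrixP => i j; rewrite !mxE (ord1 i) (ord1 j) eqxx !mulr1n; ring.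
have -> : epair (y - x) (b - a + eps * enorm (y - x)) = c (epair x a).
  by rewrite /c /epair row_mxKl row_mxEr !mxE eqxx mulr1n.
have dcont : continuous (fun w : 'rV[R]_(n + 1) => enorm (y - lsubmx w)).
  apply: (continuous_lsubmx_comp (fun z => enorm (y - z))) => z.
  exists 1 => //; exists 1 => z' _; rewrite mul1r.
  apply: (le_trans (dist_enorm _ _)).
  have -> : y - z' - (y - z) = z - z' by apply/rowP => i; rewrite !mxE; ring.
  by rewrite enormB.
have clim : c (w_ k) @[k --> \oo] --> c (epair x a).
  rewrite cE; under eq_fun do rewrite cE.
  apply: (@cvgD R 'rV[R]_(n + 1) _ \oo).
    by apply: (@cvgB R 'rV[R]_(n + 1) _ \oo _ (cst _)); [exact: cvg_cst|].
  apply: (@cvgZr_tmp R 'rV[R]_(n + 1) _ \oo).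
  apply: (@cvgM R _ \oo _ (cst eps)); first exact: cvg_cst.
  exact: (cvg_comp _ _ wlim (dcont (epair x a))).
apply: (@cvgr_to_le _ _ _ _ _ _ _ (dot_cvg nulim clim)).
have d20 : 0 < delta / 2 by lra.
have near_w : \forall k \near \oo, eball (epair x a) (delta / 2) (w_ k).
  exact: (wlim _ (eball_nbhs _ (epair x a) _ d20)).
apply: filterS near_w => k wk.
have := frw k; rewrite {1}(epairP (w_ k)) => frk.
have := epiw k; rewrite {1}(epairP (w_ k)) => /epi_epair fw_k.
apply: (frechet_normal_epi_le f xbar delta eps _ _ _ _ _ fac eps0 _ yd
  fw_k fyb frk).
have wkx : enorm (lsubmx (w_ k) - x) <= delta / 2.
  apply: le_trans wk; rewrite {2}(epairP (w_ k)) epairB; exact: enorm_epair_ge.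
have := enorm_dist_trans x (lsubmx (w_ k)) xbar.
by move: xd wkx; rewrite /eball /=; lra.
Qed.

Lemma approx_convex_clarke_subgradient_ineq f xbar : approx_convex f xbar ->
  subgradient_ineq (clarke_subdiff f) f xbar.
Proof.
move=> fac eps eps0; have [d d0 fd] := fac eps eps0.
exists (d / 2); first lra.
move=> x y v xd yd vx.
have yd' : eball xbar d y by move: yd; rewrite /eball /=; lra.
have := clarke_normal_epi_le _ _ _ _ _ _ _ _ _ fd eps0 d0 xd yd' (lexx _) vx.
rewrite dot_epair; lra.
Qed.

(** For a normal [(w, c)] at [(x, a)], the inequality for Clarke normals bounds
    the pairing with [(y - x, b - a)] by [- c eps |y - x|], and [- c] is at most
    the norm of the normal. *)
Lemma approx_convex_clarke_super_regular f xbar : locally_lipschitz f ->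
  approx_convex f xbar -> clarke_super_regular (epi f) (epair xbar (f xbar)).
Proof.
move=> flip fac; split.
- exact/epi_epair.
- exists 1 => //; apply: closedI; first exact: epi_closed.
  exact: compact_closed (@norm_hausdorff _ _) (eball_compact _ _ _).
- move=> eps eps0; have [d d0 fd] := fac eps eps0.
  exists (d / 2); first lra.
  move=> _ nu [[x [a [fxa ->]]] xd] nuN _ [[y [b [fyb ->]]] yd].
  have {}xd : eball xbar (d / 2) x.
    by move: xd; rewrite /eball /= epairB; apply: le_trans (enorm_epair_ge _ _).
  have {}yd : eball xbar d y.
    move: yd; rewrite /eball /= epairB => yd.
    have := enorm_epair_ge (y - xbar) (b - f xbar); lra.
  have := clarke_normal_epi_le _ _ _ _ _ _ _ _ _ fd eps0 d0 xd yd fyb nuN.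
  rewrite epairB [nu]epairP !dot_epair.
  move: (lsubmx nu) (nu _ _) => w c H.
  have c_le := normr_epair_ge w c; have h_le := enorm_epair_ge (y - x) (b - a).
  have cn : - c <= enorm (epair w c).
    by apply: le_trans c_le; rewrite -normrN ler_norm.
  have h0 := enorm_ge0 (y - x).
  have step : (- c) * enorm (y - x) <=
      enorm (epair w c) * enorm (epair (y - x) (b - a)).
    apply: (le_trans (ler_wpM2r h0 cn)).
    by rewrite ler_wpM2l// enorm_ge0.
  have : eps * (- c * enorm (y - x)) <=
      eps * (enorm (epair w c) * enorm (epair (y - x) (b - a))).
    by rewrite ler_pM2l.
  lra.
Qed.

Lemma clarke_subgradient_ineq_submonotone f xbar :
  subgradient_ineq (clarke_subdiff f) f xbar ->
  submonotone (limiting_subdiff f) xbar.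
Proof.
move=> fC eps eps0.
have [d d0 fd] := fC (eps / 2) (divr_gt0 eps0 (ltr0Sn _ _)).
exists d => // x1 x2 [x1d _] [x2d _] v1 v2 /limiting_subdiff_clarke v1C.
move=> /limiting_subdiff_clarke v2C.
have := fd x1 x2 v1 x1d x2d v1C; have := fd x2 x1 v2 x2d x1d v2C.
rewrite (enormB x2 x1) -[x2 - x1]opprB dotNr dotDl dotNl; lra.
Qed.

End Implications.

(** * The equivalence *)

Theorem theorem4p6 (R : realType) (n : nat) (f : 'rV[R]_n -> R)
    (xbar : 'rV[R]_n) (f_lip : locally_lipschitz f) :
  [<-> clarke_super_regular (epi f) (epair xbar (f xbar));
       approx_convex f xbar;
       forall eps : R, 0 < eps -> exists2 delta : R, 0 < delta &
         forall x y v : 'rV[R]_n, eball xbar delta x -> eball xbar delta y ->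
           clarke_subdiff f x v ->
           f y - f x >= dot v (y - x) - eps * enorm (y - x);
       submonotone (limiting_subdiff f) xbar].
Proof.
have hub := @frechet_subgradient_ineq_approx_convex R n f xbar f_lip.
tfae.
- by move=> reg; exact/hub/clarke_super_regular_frechet_subgradient_ineq.
- exact: approx_convex_clarke_subgradient_ineq.
- exact: clarke_subgradient_ineq_submonotone.
- move=> mon; apply: approx_convex_clarke_super_regular => //.
  exact/hub/submonotone_frechet_subgradient_ineq.
Qed.
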